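(* Let $G_1$ and $G_2$ be two connected graphs, each with $n$ vertices and $m$ edges, having Laplacian spectra $0=\mu_n<\mu_{n-1}\leq\cdots\leq\mu_1$ and $0=\lambda_n<\lambda_{n-1}\leq\cdots\leq\lambda_1$, respectively, with algebraic connectivities $\mu_{n-1},\lambda_{n-1}$ greater than two. Let $p$ be a positive integer such that $$\frac{2m}{p+n}<\min(\mu_{n-1}-2,\lambda_{n-1}-2).$$ Then $LE(\tilde{G_1})=LE(\tilde{G_2})$, where $\tilde{G_i}=(\overline{G_i}\vee K_p)\times K_p$ for $i=1,2$.
   Context: All graphs are finite, undirected and simple. For a graph $G$ with $N$ vertices and $M$ edges, adjacency matrix $A(G)$ and diagonal degree matrix $D(G)$, the Laplacian matrix is $L(G)=D(G)-A(G)$; its eigenvalues with multiplicity, $\mu_1,\dots,\mu_N$, form the Laplacian spectrum of $G$. The algebraic connectivity is the second smallest Laplacian eigenvalue. The Laplacian energy is $LE(G)=\sum_{i=1}^{N}\left|\mu_i-\frac{2M}{N}\right|$. $\overline{G}$ is the complement of $G$, $K_p$ the complete graph on $p$ vertices, and the join $G\vee H$ is obtained from the disjoint union of $G$ and $H$ by adding all edges between vertices of $G$ and vertices of $H$. $G\times H$ is the Cartesian product: vertex set $V(G)\times V(H)$, with $(u_1,v_1)$ adjacent to $(u_2,v_2)$ iff either $u_1=u_2$ and $v_1v_2\in E(H)$, or $v_1=v_2$ and $u_1u_2\in E(G)$. *)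

(* Defs.v *)
From HB Require Import structures.
From mathcomp Require Import all_boot all_order all_algebra.
From mathcomp Require Import complex.

Set Implicit Arguments.
Unset Strict Implicit.
Unset Printing Implicit Defensive.

Import Order.TTheory GRing.Theory Num.Theory.
Local Open Scope ring_scope.

Record sgraph := SGraph {
  vertex :> finType;
  adj : rel vertex;
  adj_sym : symmetric adj;
  adj_irrefl : irreflexive adj }.

Arguments adj {s} x y.

Definition connected (G : sgraph) := forall x y : G, connect adj x y.

Definition edges (G : sgraph) : {set {set G}} :=
  [set [set u.1; u.2] | u : G * G & adj u.1 u.2].

Definition degree (G : sgraph) (x : G) : nat := #|[set y | adj x y]|.

Section Operations.
Variables G H : sgraph.

Definition compl_adj (x y : G) := (x != y) && ~~ adj x y.

Lemma compl_adj_sym : symmetric compl_adj.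
Proof. by move=> x y; rewrite /compl_adj eq_sym adj_sym. Qed.

Lemma compl_adj_irrefl : irreflexive compl_adj.
Proof. by move=> x; rewrite /compl_adj eqxx. Qed.

Definition complement := SGraph compl_adj_sym compl_adj_irrefl.

Definition join_adj (u v : G + H) :=
  match u, v with
  | inl x, inl y => adj x y
  | inr x, inr y => adj x y
  | _, _ => true
  end.

Lemma join_adj_sym : symmetric join_adj.
Proof. by move=> [x|x] [y|y] //=; rewrite adj_sym. Qed.

Lemma join_adj_irrefl : irreflexive join_adj.
Proof. by move=> [x|x] /=; rewrite adj_irrefl. Qed.

Definition join := SGraph join_adj_sym join_adj_irrefl.

Definition cartesian_adj (u v : G * H) :=
  (u.1 == v.1) && adj u.2 v.2 || (u.2 == v.2) && adj u.1 v.1.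

Lemma cartesian_adj_sym : symmetric cartesian_adj.
Proof.
move=> u v; rewrite /cartesian_adj (eq_sym u.1) (eq_sym u.2).
by rewrite (adj_sym u.1) (adj_sym u.2).
Qed.

Lemma cartesian_adj_irrefl : irreflexive cartesian_adj.
Proof. by move=> u; rewrite /cartesian_adj !adj_irrefl !andbF. Qed.

Definition cartesian := SGraph cartesian_adj_sym cartesian_adj_irrefl.

End Operations.

Section Complete.
Variable p : nat.

Definition complete_adj (i j : 'I_p) := i != j.

Lemma complete_adj_sym : symmetric complete_adj.
Proof. by move=> i j; rewrite /complete_adj eq_sym. Qed.

Lemma complete_adj_irrefl : irreflexive complete_adj.
Proof. by move=> i; rewrite /complete_adj eqxx. Qed.

Definition complete := SGraph complete_adj_sym complete_adj_irrefl.

End Complete.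

Definition adjacency_mx (R : pzRingType) (G : sgraph) : 'M[R]_#|G| :=
  \matrix_(i, j) (adj (enum_val i) (enum_val j))%:R.

Definition degree_mx (R : pzRingType) (G : sgraph) : 'M[R]_#|G| :=
  diag_mx (\row_i (degree (enum_val i))%:R).

Definition laplacian (R : pzRingType) (G : sgraph) : 'M[R]_#|G| :=
  degree_mx R G - adjacency_mx R G.

Lemma laplacian_tr (R : pzRingType) (G : sgraph) :
  (laplacian R G)^T = laplacian R G.
Proof.
rewrite /laplacian linearB /= tr_diag_mx; congr (_ - _).
by apply/matrixP=> i j; rewrite !mxE adj_sym.
Qed.

Section Spectrum.
Variable R : rcfType.

Lemma char_poly_diag (K : comNzRingType) n (d : 'rV[K]_n) :
  char_poly (diag_mx d) = \prod_i ('X - (d 0 i)%:P).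
Proof.
rewrite char_poly_trig; last first.
  by apply/is_trig_mxP=> i j ltij; rewrite mxE -val_eqE (ltn_eqF ltij).
by apply: eq_bigr => i _; rewrite mxE eqxx.
Qed.

Lemma char_poly_conj (K : fieldType) n (P A : 'M[K]_n) :
  P \in unitmx -> char_poly (invmx P *m A *m P) = char_poly A.
Proof.
move=> uP; have uP' : map_mx polyC P \in unitmx by rewrite map_unitmx.
rewrite /char_poly /char_poly_mx !map_mxM /= map_invmx.
set Q := map_mx polyC P.
have {1}-> : 'X%:M = invmx Q *m 'X%:M *m Q.
  by rewrite mul_mx_scalar -scalemxAl mulVmx // scalemx1.
rewrite -mulmxBl -mulmxBr !det_mulmx mulrC mulrA -det_mulmx mulmxV //.
by rewrite det1 mul1r.
Qed.

Lemma symmetric_char_poly_splits n (A : 'M[R]_n) : A^T = A ->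
  exists s : seq R,
    sorted <=%R s && (char_poly A == \prod_(x <- s) ('X - x%:P)).
Proof.
move=> symA; pose toC := real_complex R; pose B := map_mx toC A.
have realB : B \is a mxOver Num.real.
  by apply/mxOverP=> i j; rewrite mxE; apply/complex_realP; exists (A i j).
have hermB : B \is hermsymmx.
  apply: realsym_hermsym realB; apply/is_hermitianmxP.
  by rewrite expr0 scale1r map_mx_id // /B map_trmx symA.
have /orthomx_spectralP defB := hermitian_normalmx hermB.
have /mxOverP real_d := hermitian_spectral_diag_real hermB.
pose s := [seq complex.Re (spectral_diag B 0 i) | i <- index_enum 'I_n].
exists (sort <=%R s); rewrite sort_le_sorted /=; apply/eqP.
apply: (map_poly_inj toC).
rewrite (perm_big s) /=; last by rewrite perm_sort.
rewrite map_char_poly -/B defB char_poly_conj ?spectral_unit //.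
rewrite char_poly_diag big_map rmorph_prod; apply: eq_bigr => i _ /=.
by rewrite rmorphB /= map_polyX map_polyC /= /toC RRe_real.
Qed.

(* The Laplacian eigenvalues with multiplicity, in nondecreasing order; this
   property determines the sequence. *)
Definition laplacian_spectrum (G : sgraph) : seq R :=
  xchoose (symmetric_char_poly_splits (laplacian_tr R G)).

Lemma laplacian_spectrum_sorted G : sorted <=%R (laplacian_spectrum G).
Proof.
by case/andP: (xchooseP (symmetric_char_poly_splits (laplacian_tr R G))).
Qed.

Lemma char_poly_laplacian G :
  char_poly (laplacian R G) = \prod_(x <- laplacian_spectrum G) ('X - x%:P).
Proof.
by case/andP: (xchooseP (symmetric_char_poly_splits (laplacian_tr R G))) => _ /eqP.
Qed.

Lemma size_laplacian_spectrum G : size (laplacian_spectrum G) = #|G|.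
Proof.
apply: succn_inj; rewrite -(size_prod_XsubC _ id) -char_poly_laplacian.
exact: size_char_poly.
Qed.

(* Equal to 0 by convention when G has fewer than two vertices. *)
Definition algebraic_connectivity (G : sgraph) : R :=
  (laplacian_spectrum G)`_1.

Definition laplacian_energy (G : sgraph) : R :=
  \sum_(x <- laplacian_spectrum G) `|x - 2 * #|edges G|%:R / #|G|%:R|.

End Spectrum.

(* Main.v *)
Require Import Defs.
From mathcomp Require Import all_boot all_order all_algebra all_fingroup.
From mathcomp Require Import complex ring lra.

(** An eigenbasis of the Laplacian of [G] containing the constant vector [1]
    yields one for the complement of [G] (the eigenvalue [mu] becomes [n - mu]
    off [1]); eigenbases of two graphs combine into one of the join and, by
    tensor products, into one of the Cartesian product.  This gives the spectrum
    of [(complement G \/ K_p) x K_p] explicitly: besides eigenvalues that depend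
    only on [n] and [p], it contains [n + p - mu] and [n + 2 p - mu] for the
    nonzero eigenvalues [mu] of [G].  The hypothesis puts all of the latter
    below the average degree, so their absolute deviations add
    up to a linear function of the sum of the [mu], which is the trace [2 m]. *)

Set Implicit Arguments.
Unset Strict Implicit.
Unset Printing Implicit Defensive.

Import Order.TTheory GRing.Theory Num.Theory.
Local Open Scope ring_scope.

(** * The Laplacian on functions and its behaviour under graph operations *)

Section Eigenbasis.
Variable F : numFieldType.

(** Acting on functions of vertices keeps the graph operations free of enumerations;
    [mulmx_laplacian] makes the link with the matrix. *)
Definition lap (G : sgraph) (f : G -> F) (x : G) : F :=
  \sum_(y | adj x y) (f x - f y).

Definition independent (T K : finType) (f : K -> T -> F) :=
  forall c : K -> F, (forall x, \sum_k c k * f k x = 0) -> forall k, c k = 0.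

(** The index type is left free so that sums and products of index types can serve for joins and
    Cartesian products. *)
Definition eigenbasis (G : sgraph) (K : finType) (f : K -> G -> F)
    (d : K -> F) :=
  [/\ #|K| = #|G|, independent f & forall k x, lap (f k) x = d k * f k x].

Definition centered (T K : finType) (k0 : K) (f : K -> T -> F) :=
  (forall x, f k0 x = 1) /\
  forall k, k != k0 -> \sum_x f k x = 0.

Lemma sum_delta (K : finType) (k : K) (f : K -> F) :
  \sum_l (l == k)%:R * f l = f k.
Proof.
rewrite (bigD1 k) //= eqxx mul1r big1 ?addr0 // => l /negPf ->.
by rewrite mul0r.
Qed.

Lemma lap_const (G : sgraph) (f : G -> F) (a : F) x :
  (forall y, f y = a) -> lap f x = 0.
Proof. by move=> fE; rewrite /lap big1 // => y _; rewrite !fE subrr. Qed.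

Lemma sum_lap (G : sgraph) (f : G -> F) : \sum_x lap f x = 0.
Proof.
rewrite /lap; under eq_bigr => x _ do rewrite sumrB.
rewrite sumrB; apply/eqP; rewrite subr_eq0; apply/eqP.
rewrite [RHS](exchange_big_dep predT) //=; apply: eq_bigr => x _.
by apply: eq_bigl => y; rewrite adj_sym.
Qed.

Lemma sum_subl (T : finType) (a : F) (f : T -> F) :
  \sum_y (a - f y) = #|T|%:R * a - \sum_y f y.
Proof. by rewrite sumrB sumr_const mulr_natl. Qed.

(** The Laplacians of [G] and of its complement add up to that of a complete graph, [n I - J] with
    [J] the all-ones matrix. *)
Lemma lap_complement (G : sgraph) (f : G -> F) (x : G) :
  @lap (complement G) f x = #|G|%:R * f x - \sum_y f y - lap f x.
Proof.
rewrite -sum_subl (bigID (fun y => adj x y)) /= /lap addrC addrK.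
rewrite [RHS](bigD1 x) /= ?adj_irrefl // subrr add0r.
by apply: eq_bigl => y; rewrite /compl_adj eq_sym andbC.
Qed.

Lemma lap_complete p (f : 'I_p -> F) (x : 'I_p) :
  @lap (complete p) f x = p%:R * f x - \sum_y f y.
Proof.
rewrite -{2}[p]card_ord -sum_subl [RHS](bigD1 x) //= subrr add0r.
by apply: eq_bigl => y; rewrite /= /complete_adj eq_sym.
Qed.

Lemma lap_join_inl (G H : sgraph) (f : G + H -> F) (x : G) :
  @lap (join G H) f (inl x) =
  lap (f \o inl) x + (#|H|%:R * f (inl x) - \sum_y f (inr y)).
Proof. by rewrite /lap big_sumType /= -sum_subl. Qed.

Lemma lap_join_inr (G H : sgraph) (f : G + H -> F) (x : H) :
  @lap (join G H) f (inr x) =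
  lap (f \o inr) x + (#|G|%:R * f (inr x) - \sum_y f (inl y)).
Proof. by rewrite /lap big_sumType /= addrC -sum_subl. Qed.

Lemma lap_cartesian (G H : sgraph) (f : G * H -> F) (x : G * H) :
  @lap (cartesian G H) f x =
  @lap G (fun u => f (u, x.2)) x.1 + @lap H (fun v => f (x.1, v)) x.2.
Proof.
(* A neighbour with the same first coordinate moves in [H]; any other neighbour moves in [G]. *)
case: x => x y /=; rewrite /lap (bigID (fun z => z.1 == x)) /= addrC.
congr (_ + _).
- transitivity (\sum_(u | adj x u) \sum_(v | v == y) (f (x, y) - f (u, v))).
    rewrite pair_big /=; apply: eq_big => -[u v] //=.
    rewrite /cartesian_adj /= eq_sym (eq_sym y).
    by case: eqP => [->|_]; rewrite ?adj_irrefl ?andbF //= andbT andbC.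
  by apply: eq_bigr => u _; rewrite big_pred1_eq.
- transitivity (\sum_(u | u == x) \sum_(v | adj y v) (f (x, y) - f (u, v))).
    rewrite pair_big /=; apply: eq_big => -[u v] //=.
    rewrite /cartesian_adj /= eq_sym.
    by case: eqP => [->|_]; rewrite ?adj_irrefl ?andbF //= andbT orbF.
  by rewrite big_pred1_eq.
Qed.

(** * Eigenbases of complements, complete graphs, joins and Cartesian products *)

Lemma eq_eigenbasis (G : sgraph) (K : finType) (f : K -> G -> F)
    (d d' : K -> F) :
  eigenbasis f d -> d =1 d' -> eigenbasis f d'.
Proof. by move=> [cK fI fE] dE; split=> // k x; rewrite fE dE. Qed.

Lemma eigenbasis_complement (G : sgraph) (K : finType) (k0 : K)
    (f : K -> G -> F) (d : K -> F) :
    eigenbasis f d -> centered k0 f ->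
  @eigenbasis (complement G) K f
    (fun k => if k == k0 then 0 else #|G|%:R - d k).
Proof.
case=> cK fI fE [f0 fS]; split=> // k x; case: eqP => [->|/eqP k_neq0].
  by rewrite (@lap_const (complement G) _ 1) ?mul0r.
by rewrite lap_complement fE fS // subr0 mulrBl.
Qed.

Definition complete_basis p (k x : 'I_p.+1) : F :=
  if k == ord0 then 1 else (x == k)%:R - (x == ord0)%:R.

Lemma complete_basis_centered p : centered ord0 (@complete_basis p).
Proof.
have sum_ind (a : 'I_p.+1) : \sum_x (x == a)%:R = 1 :> F.
  by rewrite -[RHS](sum_delta a (fun=> 1)); under [RHS]eq_bigr do rewrite mulr1.
split=> [x|k /negPf k_neq0]; rewrite /complete_basis ?eqxx // k_neq0.
by rewrite sumrB !sum_ind subrr.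
Qed.

Lemma eigenbasis_complete p :
  @eigenbasis (complete p.+1) 'I_p.+1 (@complete_basis p)
    (fun k => if k == ord0 then 0 else p.+1%:R).
Proof.
have [f0 fS] := complete_basis_centered p.
split=> // [c c0|k x]; last first.
  case: eqP => [->|/eqP k_neq0]; first
    by rewrite (@lap_const (complete p.+1) _ 1) ?mul0r.
  by rewrite lap_complete fS // subr0.
(* Summing the relation over all vertices leaves only the constant vector, since the others have sum
   zero. *)
have c_ord0 : c ord0 = 0.
  have : \sum_(x : 'I_p.+1) \sum_k c k * complete_basis k x = 0.
    by rewrite big1.
  rewrite exchange_big (bigD1 ord0) //= -mulr_sumr.
  rewrite [X in _ + X]big1 => [|k k0]; last by rewrite -mulr_sumr fS // mulr0.
  under eq_bigr do rewrite f0.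
  rewrite addr0 sumr_const card_ord => /eqP.
  by rewrite mulf_eq0 pnatr_eq0 orbF => /eqP.
move=> k; have [-> //|k_neq0] := eqVneq k ord0.
(* At vertex [k], the only non-constant basis vector that does not vanish is the one of index
   [k]. *)
have := c0 k; rewrite (bigD1 k) //= big1 => [|l l_neqk].
  by rewrite /complete_basis (negPf k_neq0) eqxx subr0 mulr1 addr0.
have [->|l_neq0] := eqVneq l ord0; first by rewrite c_ord0 mul0r.
by rewrite /complete_basis (negPf l_neq0) (negPf k_neq0) eq_sym (negPf l_neqk)
  subrr mulr0.
Qed.

(* The index [l0] of the constant vector of [H], superfluous next to that of
   [G], is reused for the vector equal to [#|H|] on [G] and to
   [- #|G|] on [H]. *)
Definition join_basis (G H : sgraph) (K L : finType) (k0 : K) (l0 : L)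
    (f : K -> G -> F) (g : L -> H -> F) (k : K + L) (x : G + H) : F :=
  match k, x with
  | inl k, inl x => f k x
  | inl k, inr _ => (k == k0)%:R
  | inr l, inl _ => (l == l0)%:R * #|H|%:R
  | inr l, inr y => if l == l0 then - #|G|%:R else g l y
  end.

Definition join_eigenvalue (G H : sgraph) (K L : finType) (k0 : K) (l0 : L)
    (d : K -> F) (e : L -> F) (k : K + L) : F :=
  match k with
  | inl k => if k == k0 then 0 else d k + #|H|%:R
  | inr l => if l == l0 then #|G|%:R + #|H|%:R else e l + #|G|%:R
  end.

(** A vector of sum zero on one side, extended by zero, has its eigenvalue raised by the order of
    the other side. The two remaining vectors, constant on each side, have eigenvalues [0] and
    [#|G| + #|H|]. *)
Lemma eigenbasis_join (G H : sgraph) (K L : finType) (k0 : K) (l0 : L) f g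
    (d : K -> F) (e : L -> F) :
    eigenbasis f d -> centered k0 f -> eigenbasis g e -> centered l0 g ->
  @eigenbasis (join G H) (K + L)%type
    (join_basis k0 l0 f g) (join_eigenvalue G H k0 l0 d e).
Proof.
move=> [cK fI fE] [f0 fS] [cL gI gE] [g0 gS]; split.
- by rewrite !card_sum cK cL.
- move=> c c0.
  have cG x : \sum_k c (inl k) * f k x + c (inr l0) * #|H|%:R = 0.
    rewrite -[RHS](c0 (inl x)) big_sumType /=; congr (_ + _).
    rewrite -(sum_delta l0 (fun l => c (inr l) * _)); apply: eq_bigr => l _.
    by rewrite mulrCA.
  have cH y : \sum_(l | l != l0) c (inr l) * g l y +
              (c (inl k0) - c (inr l0) * #|G|%:R) = 0.
    rewrite -[RHS](c0 (inr y)) big_sumType /= addrCA; congr (_ + _).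
      rewrite -(sum_delta k0 (fun k => c (inl k))); apply: eq_bigr => k _.
      by rewrite mulrC.
    rewrite addrC [RHS](bigD1 l0) //= eqxx mulrN; congr (_ + _).
    by apply: eq_bigr => l /negPf ->.
  (* As [f k0] is the constant [1], the constant term of [cG] is absorbed into its coefficient. *)
  have hG k : c (inl k) + (k == k0)%:R * (c (inr l0) * #|H|%:R) = 0.
    move: k; apply: fI => x; under eq_bigr do rewrite mulrDl.
    rewrite big_split /= -[RHS](cG x); congr (_ + _).
    under eq_bigr do rewrite -mulrA.
    by rewrite (sum_delta k0 (fun k => _ * f k x)) f0 mulr1.
  have hH l : (if l == l0 then c (inl k0) - c (inr l0) * #|G|%:R
              else c (inr l)) = 0.
    move: l; apply: gI => y; rewrite (bigD1 l0) //= eqxx g0 mulr1 addrC.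
    by rewrite -[RHS](cH y); congr (_ + _); apply: eq_bigr => l /negPf ->.
  have G_gt0 : (0 < #|G|)%N by rewrite -cK; apply/card_gt0P; exists k0.
  (* [hG k0] and [hH l0] give two values for [c (inl k0)]; equating them yields
     [c (inr l0) * (#|G| + #|H|) = 0]. *)
  have cr0 : c (inr l0) = 0.
    have := hH l0; have := hG k0; rewrite !eqxx mul1r => /eqP.
    rewrite addr_eq0 => /eqP -> /eqP; rewrite -opprD oppr_eq0 -mulrDr mulf_eq0.
    by rewrite -natrD pnatr_eq0 addn_eq0 (gtn_eqF G_gt0) andbF orbF => /eqP.
  case=> [k|l]; first by have := hG k; rewrite cr0 mul0r mulr0 addr0.
  by have := hH l; case: eqP => [-> _|].
- have card_sum (T : finType) (a : F) : \sum_(x : T) a = #|T|%:R * a.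
    by rewrite sumr_const mulr_natl.
  case=> [k|l] [x|y]; rewrite ?lap_join_inl ?lap_join_inr /=.
  + rewrite card_sum; case: eqVneq => [->|_].
      by rewrite f0 (lap_const _ f0) mulr1 !subrr mul0r addr0.
    by rewrite (fE k) mulr0 subr0 mulrDl.
  + rewrite (lap_const _ (fun=> erefl)).
    case: eqVneq => [->|/fS ->]; last by rewrite !mulr0 subrr addr0.
    by under eq_bigr do rewrite f0; rewrite card_sum subrr mul0r addr0.
  + rewrite (lap_const _ (fun=> erefl)).
    case: eqVneq => [_|/gS ->]; last by rewrite !mul0r !mulr0 subrr addr0.
    by rewrite card_sum mul1r; ring.
  + have [->|/negPf l_neq0] := eqVneq l l0.
      rewrite (@lap_const H _ (- #|G|%:R)) => [|z /=]; last by rewrite eqxx.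
      by rewrite card_sum mul1r; ring.
    rewrite card_sum mul0r mulr0 subr0 mulrDl -(gE l); congr (_ + _).
    by apply: eq_bigr => z _ /=; rewrite l_neq0.
Qed.

Lemma eigenbasis_cartesian (G H : sgraph) (K L : finType) (f : K -> G -> F)
    (g : L -> H -> F) (d : K -> F) (e : L -> F) :
    eigenbasis f d -> eigenbasis g e ->
  @eigenbasis (cartesian G H) (K * L)%type
    (fun k x => f k.1 x.1 * g k.2 x.2) (fun k => d k.1 + e k.2).
Proof.
move=> [cK fI fE] [cL gI gE]; split=> [|c c0 [k l]|[k l] [x y]].
- by rewrite !card_prod cK cL.
- suff /(_ k l) : forall k l, c (k, l) = 0 by [].
  (* Independence of [g] is used for each fixed [k]; then, with [y] fixed, that of [f] is used for
     the coefficients [\sum_l c (k, l) * g l y]. *)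
  move=> {}k; apply: gI => y; move: k; apply: fI => x.
  transitivity (\sum_k \sum_l c (k, l) * (f k x * g l y)).
    by apply: eq_bigr => k _; rewrite mulr_suml; apply: eq_bigr => l' _; ring.
  by rewrite pair_bigA -[RHS](c0 (x, y)); apply: eq_bigr => -[].
- rewrite lap_cartesian /= mulrDl mulrA -fE [e l * _]mulrCA -gE /lap.
  rewrite mulr_suml mulr_sumr.
  by congr (_ + _); apply: eq_bigr => z _; rewrite ?mulrBl ?mulrBr.
Qed.

(** * Change of basis and the constant eigenvector *)

Lemma eigenbasis_perm (G : sgraph) (K : finType) (f : K -> G -> F)
    (d : K -> F) (s : {perm K}) :
  eigenbasis f d -> eigenbasis (fun k => f (s k)) (fun k => d (s k)).
Proof.
move=> [cK fI fE]; split=> // c c0 k.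
suff : c (s^-1%g (s k)) = 0 by rewrite permK.
move: (s k); apply: fI => x; rewrite (reindex_inj (@perm_inj _ s)) /=.
by under eq_bigr do rewrite permK.
Qed.

Lemma enum_cast_bij (K : finType) n (cK : #|K| = n) :
  bijective (fun i : 'I_n => enum_val (cast_ord (esym cK) i) : K).
Proof.
exists (fun k => cast_ord cK (enum_rank k)) => k.
  by rewrite enum_valK cast_ordKV.
by rewrite cast_ordK enum_rankK.
Qed.

Lemma independent_unitmx (T K : finType) n (f : K -> T -> F)
    (cK : #|K| = n) (cT : #|T| = n) :
    independent f ->
  (\matrix_(i < n, j < n) f (enum_val (cast_ord (esym cK) i))
     (enum_val (cast_ord (esym cT) j))) \in unitmx.
Proof.
move=> fI; rewrite -row_free_unit; apply: inj_row_free => v v0.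
apply/rowP=> i; rewrite mxE.
have := fI (fun k => v 0 (cast_ord cK (enum_rank k))) _
  (enum_val (cast_ord (esym cK) i)).
rewrite enum_valK cast_ordKV; apply=> x.
move/rowP/(_ (cast_ord cT (enum_rank x))): v0; rewrite !mxE => v0.
rewrite -[RHS]v0 (reindex (fun i => enum_val (cast_ord (esym cK) i))) /=.
  apply: eq_bigr => j _.
  by rewrite mxE enum_valK cast_ordKV cast_ordK enum_rankK.
exact/onW_bij/enum_cast_bij.
Qed.

Lemma independent_span (T K : finType) (f : K -> T -> F) (h : T -> F) :
    #|K| = #|T| -> independent f ->
  exists c : K -> F, forall x, \sum_k c k * f k x = h x.
Proof.
move=> cK /(independent_unitmx cK (erefl #|T|)).
set P := \matrix_(i, j) _ => uP.
pose v := \row_j h (enum_val j) *m invmx P.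
exists (fun k => v 0 (cast_ord cK (enum_rank k))) => x.
have : (v *m P) 0 (enum_rank x) = h x by rewrite mulmxKV // mxE enum_rankK.
rewrite mxE => <-.
rewrite (reindex (fun i => enum_val (cast_ord (esym cK) i))) /=.
  apply: eq_bigr => j _; rewrite enum_valK cast_ordKV [P _ _]mxE.
  by rewrite cast_ord_id enum_rankK.
exact/onW_bij/enum_cast_bij.
Qed.

Lemma lap_sum (G : sgraph) (K : finType) (c : K -> F) (f : K -> G -> F) x :
  lap (fun y => \sum_k c k * f k y) x = \sum_k c k * lap (f k) x.
Proof.
rewrite /lap; under [RHS]eq_bigr do rewrite mulr_sumr.
rewrite [RHS]exchange_big /=; apply: eq_bigr => y _.
by rewrite -sumrB; apply: eq_bigr => k _; rewrite mulrBr.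
Qed.

(** Expand [1] in the basis: since [lap] kills it, only the coefficient at [k0] can be nonzero, so
    [f k0] is a multiple of [1] and may be replaced by it. The other vectors have sum zero because
    [lap (f k)] does and [d k] is nonzero. *)
Lemma centered_of_eigenbasis (G : sgraph) (K : finType) (k0 : K)
    (f : K -> G -> F) (d : K -> F) :
    eigenbasis f d -> (forall k, k != k0 -> d k != 0) ->
  let f' k := if k == k0 then fun=> 1 else f k in
  eigenbasis f' d /\ centered k0 f'.
Proof.
move=> [cK fI fE] d_neq0 f'.
have [c c1] := independent_span (fun=> 1) cK fI.
have cd0 k : c k * d k = 0.
  move: k; apply: fI => x; rewrite -[RHS](@lap_const G (fun=> 1) 1 x) //.
  transitivity (lap (fun y => \sum_k c k * f k y) x).
    by rewrite lap_sum; apply: eq_bigr => k _; rewrite fE mulrA.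
  by apply: eq_bigr => y _; rewrite !c1.
have c_neq0 k : k != k0 -> c k = 0.
  move=> /d_neq0 dk; have /eqP := cd0 k.
  by rewrite mulf_eq0 (negPf dk) orbF => /eqP.
have {}c1 x : c k0 * f k0 x = 1.
  rewrite -(c1 x) (bigD1 k0) //= big1 ?addr0 // => k /c_neq0 ->.
  by rewrite mul0r.
have c0_neq0 : c k0 != 0.
  have /card_gt0P[x _] : (0 < #|G|)%N.
    by rewrite -cK; apply/card_gt0P; exists k0.
  by apply: contra_eq_neq (c1 x) => ->; rewrite mul0r eq_sym oner_neq0.
rewrite /f'; split; first split=> // [b b0|k x].
(* Substituting [1 = c k0 * f k0] turns a relation on [f'] into one on [f]. *)
- have bc k : b k * (if k == k0 then c k0 else 1) = 0.
    move: k; apply: fI => x; rewrite -[RHS](b0 x); apply: eq_bigr => k _.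
    by case: eqP => [->|_]; rewrite -mulrA ?c1 ?mul1r.
  move=> k; apply/eqP; have /eqP := bc k; rewrite mulf_eq0.
  by case: (k == k0); rewrite ?(negPf c0_neq0) ?oner_eq0 orbF.
- case: eqP => [->|_]; last exact: fE.
  have /eqP := cd0 k0; rewrite mulf_eq0 (negPf c0_neq0) => /eqP ->.
  by rewrite (@lap_const _ _ 1) ?mul0r.
- split=> [x|k k_neq0]; first by rewrite eqxx.
  apply/eqP; have /eqP := sum_lap (f k); rewrite (negPf k_neq0).
  under eq_bigr do rewrite fE.
  by rewrite -mulr_sumr mulf_eq0 (negPf (d_neq0 _ k_neq0)).
Qed.

(** * From eigenbases to the characteristic polynomial *)

Lemma mulmx_laplacian (G : sgraph) (f : G -> F) (i : 'I_#|G|) :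
  \sum_j f (enum_val j) * laplacian F G j i = lap f (enum_val i).
Proof.
rewrite /lap sumrB sumr_const -mulr_natr.
under eq_bigr do rewrite !mxE mulrBr.
rewrite sumrB; congr (_ - _).
  rewrite (bigD1 i) //= eqxx mulr1n big1 ?addr0 => [|j /negPf ->].
    by rewrite /degree cardsE.
  by rewrite mulr0n mulr0.
rewrite [RHS]big_mkcond /= (reindex (@enum_val G predT)) /=.
  apply: eq_bigr => j _; rewrite adj_sym.
  by case: adj; rewrite ?mulr1 ?mulr0.
exact/onW_bij/enum_val_bij.
Qed.

(** The matrix whose rows are the basis vectors conjugates the Laplacian to the diagonal matrix of
    the eigenvalues. *)
Lemma char_poly_eigenbasis (G : sgraph) (K : finType) (f : K -> G -> F)
    (d : K -> F) :
    eigenbasis f d ->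
  char_poly (laplacian F G) = \prod_k ('X - (d k)%:P).
Proof.
move=> [cK fI fE].
have := independent_unitmx cK (erefl #|G|) fI; set P := \matrix_(i, j) _ => uP.
pose D : 'rV[F]_#|G| := \row_i d (enum_val (cast_ord (esym cK) i)).
have PL : P *m laplacian F G = diag_mx D *m P.
  apply/matrixP=> i j; rewrite mul_diag_mx !mxE cast_ord_id -fE.
  rewrite -mulmx_laplacian; apply: eq_bigr => l _.
  by rewrite [P _ _]mxE cast_ord_id.
rewrite -[laplacian F G]mul1mx -(mulVmx uP) -mulmxA PL mulmxA.
rewrite char_poly_conj // char_poly_diag [RHS](reindex
   (fun i => enum_val (cast_ord (esym cK) i))) /=.
  by apply: eq_bigr => i _; rewrite mxE.
exact/onW_bij/enum_cast_bij.
Qed.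

End Eigenbasis.

(** * The Laplacian spectrum as the eigenvalues of an eigenbasis *)

Section Energy.
Variable R : rcfType.
Local Notation toC := (real_complex R).

(** Both lists are the roots of the characteristic polynomial; the comparison takes place over
    [R[i]], where the eigenvectors live. *)
Lemma perm_spectrum (G : sgraph) (K : finType) (f : K -> G -> R[i])
    (d : K -> R) :
    eigenbasis f (fun k => toC (d k)) ->
  perm_eq (laplacian_spectrum R G) [seq d k | k : K].
Proof.
move/char_poly_eigenbasis => cpE; apply: prod_XsubC_eq.
rewrite -char_poly_laplacian; apply: (map_poly_inj toC).
rewrite map_char_poly /laplacian map_mxB /degree_mx map_diag_mx.
have -> : map_mx toC (adjacency_mx R G) = adjacency_mx R[i] G.
  by apply/matrixP=> i j; rewrite !mxE rmorph_nat.
have -> : map_mx toC (\row_i (degree (enum_val i))%:R) =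
          \row_(i < #|G|) (degree (enum_val i))%:R.
  by apply/matrixP=> i j; rewrite !mxE rmorph_nat.
rewrite cpE big_map rmorph_prod big_enum; apply: eq_bigr => k _ /=.
by rewrite rmorphB /= map_polyX map_polyC.
Qed.

(* The spectral theorem is only available over the complex numbers, hence the
   eigenvectors over [R[i]] of a matrix with real eigenvalues. *)
Lemma spectral_eigenbasis (G : sgraph) :
  exists (f : 'I_#|G| -> G -> R[i]) (d : 'I_#|G| -> R),
    eigenbasis f (fun k => toC (d k)).
Proof.
pose B := laplacian R[i] G.
have symB : B^T = B by apply: laplacian_tr.
have realB : B \is a mxOver Num.real.
  apply/mxOverP=> i j; rewrite !mxE; apply: rpredB; last exact: realn.
  by apply: rpredMn; apply: realn.
have hermB : B \is hermsymmx.
  apply: realsym_hermsym realB; apply/is_hermitianmxP.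
  by rewrite expr0 scale1r map_mx_id.
have /orthomx_spectralP defB := hermitian_normalmx hermB.
have /mxOverP real_d := hermitian_spectral_diag_real hermB.
have uP := spectral_unit B; set P := spectralmx B in defB uP.
have PB : P *m B = diag_mx (spectral_diag B) *m P.
  by rewrite {1}defB -mulmxA mulKVmx.
exists (fun k x => P k (enum_rank x)).
exists (fun k => complex.Re (spectral_diag B 0 k)); split.
- exact: card_ord.
- move=> c c0 k; pose v := \row_k c k.
  suff : v = 0 by move/rowP/(_ k); rewrite !mxE.
  rewrite -[v]mulmx1 -(mulmxV uP) mulmxA.
  suff -> : v *m P = 0 by rewrite mul0mx.
  apply/rowP=> j; rewrite !mxE -[RHS](c0 (enum_val j)).
  by apply: eq_bigr => l _; rewrite mxE enum_valK.
- move=> k x; rewrite /= RRe_real // -[x in LHS]enum_rankK -mulmx_laplacian.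
  move/matrixP/(_ k (enum_rank x)): PB; rewrite mul_diag_mx !mxE => <-.
  by apply: eq_bigr => j _; rewrite enum_valK.
Qed.

Lemma sorted_eigenbasis (G : sgraph) :
  exists f : 'I_#|G| -> G -> R[i],
    eigenbasis f (fun k => toC (laplacian_spectrum R G)`_k).
Proof.
have [f [d fd]] := spectral_eigenbasis G.
(* Seen as a tuple, the list of eigenvalues is matched to the sorted spectrum by a permutation of
   indices. *)
have /(perm_trans (perm_spectrum fd)) : 
  perm_eq [seq d k | k : 'I_#|G|] [tuple d k | k < #|G|] by [].
case/tuple_permP=> s specE; exists (fun k => f (s k)).
have [cK fI fE] := eigenbasis_perm s fd; split=> // k x.
by rewrite fE specE (nth_mktuple _ 0) tnth_mktuple.
Qed.

Lemma le_spectrum (G : sgraph) (k : 'I_#|G|) :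
  k != 0 :> nat -> algebraic_connectivity R G <= (laplacian_spectrum R G)`_k.
Proof.
move=> k_neq0; have k_gt0 : (0 < k)%N by rewrite lt0n.
apply: (sorted_leq_nth le_trans lexx _ (laplacian_spectrum_sorted R G)) => //.
  (* From [0 < k < #|G|], index [1] lies inside the spectrum, so the algebraic connectivity is not
     the default [0] here. *)
  by rewrite inE size_laplacian_spectrum (leq_ltn_trans k_gt0).
by rewrite inE size_laplacian_spectrum.
Qed.

(** Positive algebraic connectivity makes every eigenvalue of nonzero index nonzero, as
    [centered_of_eigenbasis] requires. *)
Lemma centered_eigenbasis (G : sgraph) (k0 : 'I_#|G|) :
    k0 = 0 :> nat -> 0 < algebraic_connectivity R G ->
  exists2 f : 'I_#|G| -> G -> R[i],
    eigenbasis f (fun k => toC (laplacian_spectrum R G)`_k) & centered k0 f.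
Proof.
move=> k00 ac; have [f fE] := sorted_eigenbasis G.
have /(centered_of_eigenbasis fE) [] k : 
    k != k0 -> toC (laplacian_spectrum R G)`_k != 0; last by eexists; eauto.
rewrite -val_eqE /= k00 fmorph_eq0 => k_neq0.
by rewrite gt_eqF // (lt_le_trans ac) // le_spectrum.
Qed.

(** * Degree sum, trace and energy *)

Lemma sum_degree (G : sgraph) :
  (\sum_(x : G) degree x = 2 * #|edges G|)%N.
Proof.
(* Ordered adjacent pairs are counted by first vertex, then by edge: the edge [{x, y}] comes from
   exactly [(x, y)] and [(y, x)]. *)
transitivity (\sum_(u in [set u : G * G | adj u.1 u.2]) 1)%N.
  rewrite /degree; under eq_bigr do rewrite -sum1dep_card.
  by rewrite pair_big_dep /=; apply: eq_bigl => u; rewrite inE.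
rewrite (partition_big_imset (fun u : G * G => [set u.1; u.2])) /= mulnC.
have -> : edges G =
    [set [set u.1; u.2] | u in [set u : G * G | adj u.1 u.2]].
  by apply: eq_imset => u.
rewrite -sum_nat_const; apply: eq_bigr => e /imsetP[[x y]].
rewrite inE /= => xy ->.
have x_neqy : x != y by apply: contraTneq xy => ->; rewrite adj_irrefl.
rewrite sum1dep_card; transitivity #|[set (x, y); (y, x)]|; last first.
  by rewrite cards2 xpair_eqE negb_and x_neqy.
apply: eq_card => -[u v]; rewrite !inE /= !xpair_eqE.
apply/andP/orP=> [[uv /eqP/setP eq_uv]|].
  have u_neqv : u != v by apply: contraTneq uv => ->; rewrite adj_irrefl.
  have := eq_uv u; have := eq_uv v; rewrite !inE !eqxx orbT /=.
  case/esym/orP=> /eqP vE; subst; case/esym/orP=> /eqP uE; subst.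
  - by rewrite eqxx in u_neqv.
  - by right; rewrite !eqxx.
  - by left; rewrite !eqxx.
  - by rewrite eqxx in u_neqv.
by case=> /andP[/eqP-> /eqP->]; rewrite ?xy ?[adj y x]adj_sym ?xy // setUC.
Qed.

(** Both sides are the trace, read off from the subleading coefficient of the characteristic
    polynomial and from the diagonal. *)
Lemma sum_spectrum (G : sgraph) :
  \sum_(x <- laplacian_spectrum R G) x = 2 * #|edges G|%:R.
Proof.
rewrite -natrM -sum_degree.
have [G0|G_gt0] := posnP #|G|.
  have := size_laplacian_spectrum R G; rewrite G0 => /size0nil ->.
  rewrite big_nil big1 // => x; have := fintype0 x G0.
  by [].
have := char_poly_trace (laplacian R G) G_gt0.
rewrite char_poly_laplacian -{1}(size_laplacian_spectrum R).
rewrite coefPn_prod_XsubC; last first.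
  by rewrite size_laplacian_spectrum -lt0n.
move/oppr_inj ->; rewrite /mxtrace natr_sum.
rewrite [RHS](reindex (@enum_val G predT)) /=; last exact/onW_bij/enum_val_bij.
by apply: eq_bigr => i _; rewrite !mxE eqxx adj_irrefl subr0.
Qed.

(** By [sum_spectrum] the average degree is the mean eigenvalue, so the energy depends on the
    eigenvalues alone. *)
Lemma energy_eigenbasis (G : sgraph) (K : finType) (f : K -> G -> R[i])
    (d : K -> R) :
    eigenbasis f (fun k => toC (d k)) ->
  laplacian_energy R G = \sum_k `|d k - (\sum_l d l) / #|G|%:R|.
Proof.
move/perm_spectrum=> specE; rewrite /laplacian_energy -sum_spectrum.
have sumE (h : R -> R) :
    \sum_(x <- laplacian_spectrum R G) h x = \sum_k h (d k).
  by rewrite (perm_big _ specE) big_map big_enum.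
by rewrite !sumE.
Qed.

(* The value [a] is the average degree, and [e] runs over the Laplacian
   eigenvalues of [K_p]. *)
Definition energy_formula (n m p : nat) : R :=
  let a := n%:R + 2 * p%:R - 2 - 2 * m%:R / (n + p)%:R in
  \sum_(l < p) (let e : R := if l == 0 :> nat then 0 else p%:R in
    `|e - a| + (n.-1%:R * (a - e - n%:R - p%:R) + 2 * m%:R) +
    p%:R * `|p%:R + n%:R + e - a|).

Lemma energy_complement_join (G : sgraph) (p : nat) :
    2 < algebraic_connectivity R G ->
    2 * #|edges G|%:R / (p.+1 + #|G|)%:R < algebraic_connectivity R G - 2 ->
  laplacian_energy R
    (cartesian (join (complement G) (complete p.+1)) (complete p.+1)) =
  energy_formula #|G| #|edges G| p.+1.
Proof.
set ac := algebraic_connectivity R G => ac2 hp.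
set n := #|G|; set m := #|edges G|; set q := p.+1.
(* An empty graph would have the default connectivity [0], which is not above [2]. *)
have n_gt0 : (0 < #|G|)%N.
  rewrite lt0n; apply: contraTneq ac2 => G0.
  have := size_laplacian_spectrum R G; rewrite G0 => /size0nil s0.
  by rewrite /ac /algebraic_connectivity s0 /= -leNgt.
pose k0 : 'I_#|G| := Ordinal n_gt0.
have [f fE fC] := @centered_eigenbasis G k0 erefl (lt_trans (ltr0Sn R 1) ac2).
set s := laplacian_spectrum R G in fE.
have sumS : \sum_(k < n) s`_k = 2 * m%:R.
  by rewrite -sum_spectrum (big_nth 0) size_laplacian_spectrum big_mkord.
(* The eigenvector of index [k0] is the constant [1], which [lap] kills. *)
have s0 : s`_0 = 0.
  have [_ _ /(_ k0 (enum_val k0))] := fE; have [f0 _] := fC.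
  by rewrite (lap_const _ f0) f0 mulr1 => /esym/eqP; rewrite fmorph_eq0 => /eqP.
have cE := eigenbasis_complement fE fC.
have qC := complete_basis_centered R[i] p.
have qE := eigenbasis_complete R[i] p.
have jE := @eigenbasis_join _ (complement G) (complete p.+1) _ _ k0 ord0 _ _ _ _
  cE fC qE qC.
(* Eigenvalues of the join. All indices on the [K_q] side give [n + q]: for [ord0] it is the sum of
   the orders, otherwise the eigenvalue [q] of [K_q] raised by [n]. *)
pose D (k : 'I_n + 'I_q) : R :=
  if k is inl k then if k == k0 then 0 else n%:R + q%:R - s`_k else n%:R + q%:R.
pose E (l : 'I_q) : R := if l == 0 :> nat then 0 else q%:R.
have EE l : (if l == ord0 then 0 else p.+1%:R) = toC (E l).
  by rewrite /E -val_eqE /=; case: ifP; rewrite ?rmorph0 ?rmorph_nat.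
have tE := eq_eigenbasis (d' := fun k => toC (D k.1 + E k.2))
  (eigenbasis_cartesian jE qE) _.
rewrite (energy_eigenbasis (tE _)) => [{tE}|]; last first.
  case=> -[k|k] l; rewrite rmorphD /= -[in RHS]EE; congr (_ + _).
    case: (k == k0); rewrite ?rmorph0 // rmorphB rmorphD !rmorph_nat card_ord.
    exact: addrAC.
  by rewrite rmorphD !rmorph_nat card_ord; case: eqP; rewrite // addrC.
have cardT : #|cartesian (join (complement G) (complete q)) (complete q)| =
             ((n + q) * q)%N by rewrite card_prod card_sum !card_ord.
have nq_neq0 : n%:R + q%:R != 0 :> R by rewrite -natrD addnS pnatr_eq0.
have q_neq0 : q%:R != 0 :> R by rewrite pnatr_eq0.
have n1E : n.-1%:R = n%:R - 1 :> R by rewrite -subn1 natrB.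
have card_neq0 N (i : 'I_N) : \sum_(j < N | j != i) 1 = N.-1%:R :> R.
  by rewrite sumr_const cardC1 card_ord.
have sumS0 : \sum_(k < n | k != k0) s`_k = 2 * m%:R.
  by rewrite -sumS [RHS](bigD1 k0) //= s0 add0r.
have sum_const (T : finType) (c : R) : \sum_(t : T) c = c * #|T|%:R.
  by rewrite sumr_const mulr_natr.
have sumD : \sum_k D k = (n%:R + q%:R - 1) * (n%:R + q%:R) - 2 * m%:R.
  rewrite big_sumType /= sum_const card_ord (bigD1 k0) //= ?eqxx add0r.
  rewrite (eq_bigr (fun k : 'I_n => (n%:R + q%:R) * 1 - s`_k)); last first.
    by move=> k /negPf ->; rewrite mulr1.
  by rewrite sumrB sumS0 -mulr_sumr card_neq0 n1E; ring.
have sumE : \sum_l E l = (q%:R - 1) * q%:R.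
  rewrite (bigD1 ord0) //= /E ?eqxx add0r.
  rewrite (eq_bigr (fun=> q%:R * 1)); last first.
    by move=> l /negPf; rewrite -val_eqE /= => ->; rewrite mulr1.
  rewrite -mulr_sumr card_neq0 /= mulrC /q.
  by rewrite -[X in _ = (X - 1) * _]natr1 addrK.
(* The mean of [D k + E l] is the mean of [D], [n + q - 1 - 2 m / (n + q)], plus the mean of [E],
   [q - 1]. *)
have avgE : (\sum_k (D k.1 + E k.2)) /
    #|cartesian (join (complement G) (complete q)) (complete q)|%:R =
    n%:R + 2 * q%:R - 2 - 2 * m%:R / (n + q)%:R.
  rewrite cardT -(pair_bigA _ (fun k l => D k + E l)) /=.
  under eq_bigr => k _ do rewrite big_split /= sum_const card_ord sumE.
  rewrite big_split /= sum_const card_sum !card_ord -mulr_suml sumD.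
  by rewrite natrM natrD; field; rewrite nq_neq0.
rewrite avgE /energy_formula; set a := n%:R + _ - _ - _.
rewrite -(pair_bigA _ (fun k l => `|D k + E l - a|)) exchange_big /=.
apply: eq_bigr => l _; rewrite -/(E l) big_sumType /=.
congr (_ + _); last first.
  by rewrite sumr_const card_ord mulr_natl [q%:R + _]addrC.
rewrite (bigD1 k0) //= ?eqxx add0r; congr (_ + _).
rewrite (eq_bigr (fun k : 'I_n => (a - E l - n%:R - q%:R) * 1 + s`_k)).
  by rewrite big_split /= sumS0 -mulr_sumr card_neq0 mulrC.
(* From [ac <= s_k] and [E l <= q], the eigenvalue [n + q - s_k + E l] is at most [n + 2 q - ac],
   which [hp] puts below [a]; hence the sign. *)
move=> k k_neq0; rewrite (negPf k_neq0) ler0_norm; first by ring.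
have k_gt : ac <= s`_k by apply: le_spectrum; rewrite -val_eqE in k_neq0.
have El : E l <= q%:R by rewrite /E; case: ifP.
by move: hp; rewrite addnC -/n -/m -/q /a; lra.
Qed.

End Energy.

Theorem theorem4p6 (R : rcfType) (G1 G2 : sgraph) (n m p : nat)
    (conn1 : connected G1) (conn2 : connected G2)
    (order1 : #|G1| = n) (order2 : #|G2| = n)
    (size1 : #|edges G1| = m) (size2 : #|edges G2| = m)
    (ac1 : 2 < algebraic_connectivity R G1)
    (ac2 : 2 < algebraic_connectivity R G2)
    (p_gt0 : (0 < p)%N)
    (hp : 2 * m%:R / (p + n)%:R
          < Num.min (algebraic_connectivity R G1 - 2)
                    (algebraic_connectivity R G2 - 2)) :
  laplacian_energy R
    (cartesian (join (complement G1) (complete p)) (complete p)) =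
  laplacian_energy R
    (cartesian (join (complement G2) (complete p)) (complete p)).
Proof.
(* Both energies equal [energy_formula] at the common [n], [m] and [p]. *)
case: p p_gt0 hp => // p _; rewrite lt_min => /andP[hp1 hp2].
by rewrite !energy_complement_join ?order1 ?order2 ?size1 ?size2.
Qed.
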